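(* Let $G$ be a group (written additively), $k$ a field, $\chi:G\to k^\times$ a character, and $(\mathcal D,F)$ a $G$-equivariant category. Suppose $(\mathbb S,s,\kappa)$ is a $\chi$-equivariant Serre structure for $(\mathcal D,F)$. Let $\mathcal C=\mathcal D/G$ be the orbit category. Define $\mathbb S^{\mathcal C}:\mathcal C\to\mathcal C$ to be $\mathbb S$ on objects and to send $f\in\mathcal C^p(w,x)=\mathcal D(w,F^px)$ to $s^p_x\circ\mathbb S(f)\in\mathcal D(\mathbb Sw,F^p\mathbb Sx)$, and define $\kappa^{\mathcal C}_{u,v}:\mathcal C(u,v)\to\mathcal C(v,\mathbb Su)^*$ to have degree $p$ component $$\mathcal C^p(u,v)=\mathcal D(u,F^pv)\xrightarrow{\chi(p)\kappa_{u,F^pv}}\mathcal D(F^pv,\mathbb Su)^*\xrightarrow{(F^p)^*}\mathcal D(v,F^{-p}\mathbb Su)^*=\mathcal C^p(v,\mathbb S^{\mathcal C}u)^*.$$ Then $(\mathbb S^{\mathcal C},\underline 0,\kappa^{\mathcal C})$ is a $\chi$-hom-graded Serre structure for $\mathcal C$, where $\underline0$ is the constant function with value $0$.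
   Context: All categories and functors are $k$-linear; $V^*=\mathrm{Hom}_k(V,k)$. For hom-graded $\mathcal C$, $\mathcal C^p(x,y)^*$ denotes the degree $p$ part of $\mathcal C(x,y)^*$, that is $(\mathcal C^{-p}(x,y))^*$. $G$-equivariant category: a pair $(\mathcal D,F)$ with $F:G\to\mathrm{Autom}(\mathcal D)$ a group homomorphism to the automorphisms of $\mathcal D$; write $F^p=F(p)$. Serre structure on $\mathcal D$: $(\mathbb S,\kappa)$ with $\mathbb S$ an autoequivalence and isomorphisms $\kappa_{x,y}:\mathcal D(x,y)\to\mathcal D(y,\mathbb Sx)^*$ (hom spaces finite-dimensional) with $\kappa(hg)(u)=\kappa(g)(uh)$ and $\kappa(gf)(u)=\kappa(g)(\mathbb S(f)u)$ for composable $f,g,h$ and $u$ of the appropriate type. For an automorphism $E$, $\zeta_E:\mathbb SE\to E\mathbb S$ is the canonical natural isomorphism characterised by $\kappa_{Ey,x}(e)(u)=\kappa_{y,E^{-1}x}(E^{-1}e)(E^{-1}(\zeta_{E,y}u))$ for $e\in\mathcal D(Ey,x)$, $u\in\mathcal D(x,\mathbb SEy)$. A $\chi$-equivariant Serre structure on $(\mathcal D,F)$ is a triple $(\mathbb S,s,\kappa)$ with $(\mathbb S,\kappa)$ a Serre structure and $s=(s^p)_{p\in G}$, $s^p=\chi(p)\zeta_{F^p}:\mathbb SF^p\to F^p\mathbb S$. Orbit category $\mathcal D/G$: same objects as $\mathcal D$, $\mathcal C^p(x,y)=\mathcal D(x,F^py)$, $\mathcal C(x,y)=\bigoplus_p\mathcal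 C^p(x,y)$; the composite of $f\in\mathcal C^p(x,y)$ and $g\in\mathcal C^q(y,z)$ is $F^p(g)\circ f$. $\chi$-hom-graded Serre structure on a $G$-hom-graded category $\mathcal C$ with finite-dimensional graded pieces: a triple $(\mathbb S,\ell,\kappa)$ where $\mathbb S$ is an autoequivalence, $\ell:\mathrm{ob}\,\mathcal C\to G$, with $\deg\mathbb S(f)=\deg f+\ell(y)-\ell(x)$ for homogeneous $f:x\to y$, and $\kappa_{x,y}:\mathcal C(x,y)\to\mathcal C(y,\mathbb Sx)^*$ (graded dual) are isomorphisms with $\kappa(hg)(u)=\chi(\deg h)\kappa(g)(uh)$, $\kappa(gf)(u)=\kappa(g)(\mathbb S(f)u)$ for homogeneous morphisms, restricting to isomorphisms $\mathcal C^p(x,y)\to\mathcal C^{p-\ell(x)}(y,\mathbb Sx)^*$. *)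

(* Defs.v *)
From HB Require Import structures.
From mathcomp Require Import all_boot all_order all_algebra.
From mathcomp Require Import boolp classical_sets functions cardinality fsbigop.

Set Implicit Arguments.
Unset Strict Implicit.
Unset Printing Implicit Defensive.

Import GRing.Theory.
Local Open Scope ring_scope.

(* Groups are [groupType]s, hence written multiplicatively and not assumed
   commutative: [p * q], [1] and [p^-1] stand for p + q, 0 and -p. *)

Record character (G : groupType) (k : fieldType) := Character {
  char_fun :> G -> k;
  char_neq0 : forall p, char_fun p != 0;
  charM : forall p q, char_fun (p * q)%g = char_fun p * char_fun q
}.

Record lincat (k : fieldType) := LinCat {
  ob :> Type;
  mor : ob -> ob -> lmodType k;
  idm : forall x, mor x x;
  compm : forall x y z, mor y z -> mor x y -> mor x z;
  compA : forall x y z w (f : mor x y) (g : mor y z) (h : mor z w),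
    compm h (compm g f) = compm (compm h g) f;
  comp1m : forall x y (f : mor x y), compm (idm y) f = f;
  compm1 : forall x y (f : mor x y), compm f (idm x) = f;
  comp_linl : forall x y z (f : mor x y), linear (fun g : mor y z => compm g f);
  comp_linr : forall x y z (g : mor y z), linear (fun f : mor x y => compm g f)
}.

Arguments mor {k l}.
Arguments idm {k l} x.
Arguments compm {k l x y z}.
Notation "g \oc f" := (compm g f) (at level 50, left associativity).

(* No axioms here: functoriality is part of [is_autoequivalence], hence of
   every notion of Serre structure below. *)
Record prefunctor k (C D : lincat k) := PreFunctor {
  pfob :> C -> D;
  fmap : forall x y, mor x y -> mor (pfob x) (pfob y)
}.
Arguments fmap {k C D} p {x y}.

Record is_functor k (C D : lincat k) (S : prefunctor C D) : Prop := IsFunctor {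
  fmap1 : forall x, fmap S (idm x) = idm (S x);
  fmapM : forall x y z (f : mor x y) (g : mor y z),
    fmap S (g \oc f) = fmap S g \oc fmap S f;
  fmap_linear : forall x y, linear (fun f : mor x y => fmap S f)
}.

Record functor k (C D : lincat k) := Functor {
  prefun :> prefunctor C D;
  functorP : is_functor prefun
}.

Definition pfid k (C : lincat k) : prefunctor C C :=
  PreFunctor (fun x y (f : mor x y) => f).
Definition pfcomp k (C D E : lincat k) (T : prefunctor D E)
    (S : prefunctor C D) : prefunctor C E :=
  @PreFunctor k C E (fun x => T (S x)) (fun x y f => fmap T (fmap S f)).

Lemma functor_eq k (C D : lincat k) (S T : functor C D) :
  S = T :> prefunctor C D -> S = T.
Proof.
by case: S T => [S hS] [T hT] /= e; subst T; rewrite (Prop_irrelevance hS hT).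
Qed.

Lemma pfid_functor k (C : lincat k) : is_functor (pfid C).
Proof. by []. Qed.
Lemma pfcomp_functor k (C D E : lincat k) (T : functor D E) (S : functor C D) :
  is_functor (pfcomp T S).
Proof.
case: T S => T [T1 TM TL] [S [S1 SM SL]]; split=> /=.
- by move=> x; rewrite S1 T1.
- by move=> x y z f g; rewrite SM TM.
- by move=> x y a f g /=; rewrite SL TL.
Qed.
Definition fid k (C : lincat k) := Functor (pfid_functor C).
Definition fcomp k (C D E : lincat k) (T : functor D E) (S : functor C D) :=
  Functor (pfcomp_functor T S).

Record is_nat_iso k (C D : lincat k) (S T : prefunctor C D)
    (eta : forall x, mor (S x) (T x)) : Prop := IsNatIso {
  nat_isoN : forall x y (f : mor x y),
    eta y \oc fmap S f = fmap T f \oc eta x;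
  nat_isoI : forall x, exists g : mor (T x) (S x),
    g \oc eta x = idm (S x) /\ eta x \oc g = idm (T x)
}.

Definition is_autoequivalence k (C : lincat k) (S : prefunctor C C) : Prop :=
  is_functor S /\
  exists T : functor C C,
    (exists eta, @is_nat_iso k C C (pfid C) (pfcomp T S) eta) /\
    (exists eps, @is_nat_iso k C C (pfcomp S T) (pfid C) eps).

(* Automorphisms are strict: the composites with the inverse are equal, not
   just isomorphic, to the identity functor. *)
Record autom k (D : lincat k) := Autom {
  autom_fun :> functor D D;
  autom_inv : functor D D;
  autom_funK : fcomp autom_inv autom_fun = fid D;
  autom_invK : fcomp autom_fun autom_inv = fid D
}.

Section AutomGroup.
Variables (k : fieldType) (D : lincat k).
Implicit Types A B : autom D.

Lemma fcompA (T S R : functor D D) : fcomp T (fcomp S R) = fcomp (fcomp T S) R.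
Proof. exact: functor_eq. Qed.
Lemma fcomp1f (S : functor D D) : fcomp (fid D) S = S.
Proof. by apply: functor_eq; case: S => -[]. Qed.
Lemma fcompf1 (S : functor D D) : fcomp S (fid D) = S.
Proof. by apply: functor_eq; case: S => -[]. Qed.

Lemma autom_eq A B : A = B :> functor D D -> A = B.
Proof.
case: A B => [A A' AK A'K] [B B' BK B'K] /= e; subst B.
have e : A' = B' by rewrite -(fcompf1 A') -B'K fcompA AK fcomp1f.
by subst B'; rewrite (Prop_irrelevance AK BK) (Prop_irrelevance A'K B'K).
Qed.

Definition autom_one := Autom (fcomp1f (fid D)) (fcomp1f (fid D)).
Definition autom_invg A := Autom (autom_invK A) (autom_funK A).
Lemma autom_mulK A B :
  fcomp (fcomp (autom_inv B) (autom_inv A)) (fcomp A B) = fid D.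
Proof.
by rewrite -fcompA (fcompA (autom_inv A)) autom_funK fcomp1f autom_funK.
Qed.
Definition autom_mul A B :=
  Autom (autom_mulK A B) (autom_mulK (autom_invg B) (autom_invg A)).

Lemma autom_mulA : associative autom_mul.
Proof. by move=> A B C; apply/autom_eq/fcompA. Qed.
Lemma autom_mul1 : left_id autom_one autom_mul.
Proof. by move=> A; apply/autom_eq/fcomp1f. Qed.
Lemma autom_1mul : right_id autom_one autom_mul.
Proof. by move=> A; apply/autom_eq/fcompf1. Qed.
Lemma autom_mulV : left_inverse autom_one autom_invg autom_mul.
Proof. by move=> A; apply/autom_eq/autom_funK. Qed.
Lemma autom_Vmul : right_inverse autom_one autom_invg autom_mul.
Proof. by move=> A; apply/autom_eq/autom_invK. Qed.

HB.instance Definition _ := gen_eqMixin (autom D).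
HB.instance Definition _ := gen_choiceMixin (autom D).
HB.instance Definition _ := isGroup.Build (autom D)
  autom_mulA autom_mul1 autom_1mul autom_mulV autom_Vmul.
End AutomGroup.

Section Casts.
Variables (k : fieldType) (D : lincat k).

Definition castcod (x y y' : D) (e : y = y') (f : mor x y) : mor x y' :=
  ecast y (mor x y) e f.
Definition castdom (x x' y : D) (e : x = x') (f : mor x y) : mor x' y :=
  ecast x (mor x y) e f.

Lemma castcod_id (x y : D) (e : y = y) (f : mor x y) : castcod e f = f.
Proof. by rewrite (Prop_irrelevance e erefl). Qed.
Lemma castdom_id (x y : D) (e : x = x) (f : mor x y) : castdom e f = f.
Proof. by rewrite (Prop_irrelevance e erefl). Qed.
Lemma castcod_trans (x y y' y'' : D) (e : y = y') (e' : y' = y'')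
    (f : mor x y) : castcod e' (castcod e f) = castcod (etrans e e') f.
Proof. by subst y' y''; rewrite !castcod_id. Qed.
Lemma comp_castcod (x y z z' : D) (e : z = z') (g : mor y z) (f : mor x y) :
  castcod e g \oc f = castcod e (g \oc f).
Proof. by subst z'. Qed.
Lemma comp_cast (x y y' z : D) (e : y = y') (g : mor y z) (f : mor x y) :
  castdom e g \oc castcod e f = g \oc f.
Proof. by subst y'. Qed.
Lemma fmap_castcod (S : prefunctor D D) (x y y' : D) (e : y = y')
    (f : mor x y) : fmap S (castcod e f) = castcod (congr1 S e) (fmap S f).
Proof. by subst y'. Qed.
Lemma castcod_linear (x y y' : D) (e : y = y') :
  linear (fun f : mor x y => castcod e f).
Proof. by subst y'. Qed.
Lemma fmap_prefun_eq (S T : functor D D) (e : S = T) (x y : D)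
    (f : mor x y) :
  fmap T f = castdom (congr1 (fun R : functor D D => R x) e)
               (castcod (congr1 (fun R : functor D D => R y) e) (fmap S f)).
Proof. by subst T. Qed.
End Casts.

Definition autom_obK k (D : lincat k) (A : autom D) (x : D) :
    autom_inv A (A x) = x :=
  congr1 (fun R : functor D D => R x) (autom_funK A).

Definition fin_dim (k : fieldType) (V : lmodType k) (P : V -> Prop) : Prop :=
  exists n (b : 'I_n -> V), (forall i, P (b i)) /\
    forall v, P v -> exists c : 'I_n -> k, v = \sum_i c i *: b i.

(* The map v |-> kappa v is a linear isomorphism from V to the dual of W. *)
Definition dual_iso (k : fieldType) (V W : lmodType k)
    (kappa : V -> W -> k) : Prop :=
  [/\ forall w, scalar (fun v => kappa v w),
      forall v, scalar (kappa v)
    & forall phi : W -> k, scalar phi -> exists! v, kappa v = phi].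

Section Serre.
Variables (k : fieldType) (D : lincat k).

Record is_serre (S : prefunctor D D)
    (kappa : forall x y : D, mor x y -> mor y (S x) -> k) : Prop := IsSerre {
  serre_autoeq : is_autoequivalence S;
  serre_fin_dim : forall x y : D, fin_dim (fun _ : mor x y => True);
  serre_dual : forall x y, dual_iso (@kappa x y);
  serre_compl : forall x y z (g : mor x y) (h : mor y z) (u : mor z (S x)),
    kappa _ _ (h \oc g) u = kappa _ _ g (u \oc h);
  serre_compr : forall w x y (f : mor w x) (g : mor x y) (u : mor y (S w)),
    kappa _ _ (g \oc f) u = kappa _ _ g (fmap S f \oc u)
}.

Definition is_zeta (S : prefunctor D D)
    (kappa : forall x y : D, mor x y -> mor y (S x) -> k) (E : autom D)
    (zeta : forall y, mor (S (E y)) (E (S y))) : Prop :=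
  @is_nat_iso k D D (pfcomp S E) (pfcomp E S) zeta /\
  forall x y (e : mor (E y) x) (u : mor x (S (E y))),
    kappa (E y) x e u =
    kappa y (autom_inv E x)
      (castdom (autom_obK E y) (fmap (autom_inv E) e))
      (castcod (autom_obK E (S y)) (fmap (autom_inv E) (zeta y \oc u))).

Definition is_equivariant_serre (G : groupType) (chi : character G k)
    (F : UMagmaMorphism.type G (autom D)) (S : prefunctor D D)
    (s : forall p y, mor (S (F p y)) (F p (S y)))
    (kappa : forall x y : D, mor x y -> mor y (S x) -> k) : Prop :=
  is_serre kappa /\
  forall p, exists zeta, is_zeta kappa zeta /\
    forall y, s p y = chi p *: zeta y.
End Serre.
Arguments is_serre {k D} S kappa.
Arguments is_zeta {k D} S kappa E zeta.
Arguments is_equivariant_serre {k D G} chi F S s kappa.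

(* Each hom space is the internal direct sum of its homogeneous parts
   [homog p]. *)
Record hom_graded (k : fieldType) (G : groupType) := HomGraded {
  hg_cat :> lincat k;
  homog : G -> forall x y : hg_cat, mor x y -> Prop;
  homog0 : forall p (x y : hg_cat), homog p (0 : mor x y);
  homog_lin : forall p (x y : hg_cat) a (f g : mor x y),
    homog p f -> homog p g -> homog p (a *: f + g);
  homog_span : forall (x y : hg_cat) (f : mor x y),
    exists (r : seq G) (c : G -> mor x y),
      [/\ uniq r, forall p, homog p (c p) & f = \sum_(p <- r) c p];
  homog_indep : forall (x y : hg_cat) (r : seq G) (c : G -> mor x y),
    uniq r -> (forall p, homog p (c p)) -> \sum_(p <- r) c p = 0 ->
    forall p, p \in r -> c p = 0;
  homog1 : forall x : hg_cat, homog 1%g (idm x);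
  homogM : forall p q (x y z : hg_cat) (f : mor x y) (g : mor y z),
    homog p f -> homog q g -> homog (p * q)%g (g \oc f)
}.
Arguments homog {k G h} p {x y}.

Section HomGradedSerre.
Variables (k : fieldType) (G : groupType) (C : hom_graded k G).

(* The graded dual is realised inside the space of all linear functionals:
   its degree p part consists of the functionals that vanish on all
   homogeneous parts of degree different from -p, and the whole graded dual of
   those that vanish on all but finitely many homogeneous parts. *)
Definition dual_homog (p : G) (x y : C) (phi : mor x y -> k) : Prop :=
  scalar phi /\ forall q f, homog q f -> q != (p^-1)%g -> phi f = 0.
Definition graded_dual (x y : C) (phi : mor x y -> k) : Prop :=
  scalar phi /\
  exists r : seq G, forall q f, homog q f -> q \notin r -> phi f = 0.

Record is_hom_graded_serre (chi : character G k) (S : prefunctor C C)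
    (l : C -> G) (kappa : forall x y : C, mor x y -> mor y (S x) -> k) : Prop :=
  IsHomGradedSerre {
  hgs_autoeq : is_autoequivalence S;
  hgs_fin_dim : forall p (x y : C), fin_dim (fun f : mor x y => homog p f);
  hgs_deg : forall p (x y : C) (f : mor x y),
    homog p f -> homog (p * l y * (l x)^-1)%g (fmap S f);
  hgs_linear : forall x y (u : mor y (S x)),
    scalar (fun f : mor x y => kappa x y f u);
  hgs_dual : forall x y (f : mor x y), graded_dual (kappa x y f);
  hgs_iso : forall x y (phi : mor y (S x) -> k), graded_dual phi ->
    exists! f : mor x y, kappa x y f = phi;
  hgs_dual_homog : forall p x y (f : mor x y), homog p f ->
    dual_homog (p * (l x)^-1)%g (kappa x y f);
  hgs_iso_homog : forall p x y (phi : mor y (S x) -> k),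
    dual_homog (p * (l x)^-1)%g phi ->
    exists! f : mor x y, homog p f /\ kappa x y f = phi;
  hgs_compl : forall p q r x y z
      (g : mor x y) (h : mor y z) (u : mor z (S x)),
    homog p g -> homog q h -> homog r u ->
    kappa _ _ (h \oc g) u = chi q * kappa _ _ g (u \oc h);
  hgs_compr : forall p q r w x y
      (f : mor w x) (g : mor x y) (u : mor y (S w)),
    homog p f -> homog q g -> homog r u ->
    kappa _ _ (g \oc f) u = kappa _ _ g (fmap S f \oc u)
}.
End HomGradedSerre.
Arguments is_hom_graded_serre {k G C} chi S l kappa.

Section DirectSum.
Variables (k : fieldType) (I : choiceType) (V : I -> lmodType k).

Record dsum := DSum {
  dsum_fun :> forall i, V i;
  dsum_fin : exists r : seq I, forall i, i \notin r -> dsum_fun i = 0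
}.

Lemma dsumP (f g : dsum) : (forall i, f i = g i) -> f = g.
Proof.
case: f g => [f hf] [g hg] /= e.
have e' : f = g by apply: functional_extensionality_dep.
by subst g; rewrite (Prop_irrelevance hf hg).
Qed.

HB.instance Definition _ := gen_eqMixin dsum.
HB.instance Definition _ := gen_choiceMixin dsum.

Lemma dsum0_fin : exists r : seq I, forall i, i \notin r -> (0 : V i) = 0.
Proof. by exists [::]. Qed.
Lemma dsumD_fin (f g : dsum) :
  exists r : seq I, forall i, i \notin r -> f i + g i = 0.
Proof.
case: f g => [f [r hr]] [g [t ht]] /=; exists (r ++ t) => i.
by rewrite mem_cat negb_or => /andP[/hr-> /ht->]; rewrite addr0.
Qed.
Lemma dsumN_fin (f : dsum) : exists r : seq I, forall i, i \notin r -> - f i = 0.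
Proof. by case: f => [f [r hr]]; exists r => i /hr /= ->; rewrite oppr0. Qed.
Lemma dsumZ_fin a (f : dsum) :
  exists r : seq I, forall i, i \notin r -> a *: f i = 0.
Proof. by case: f => [f [r hr]]; exists r => i /hr /= ->; rewrite scaler0. Qed.

Definition dsum0 := DSum dsum0_fin.
Definition dsumD f g := DSum (dsumD_fin f g).
Definition dsumN f := DSum (dsumN_fin f).
Definition dsumZ a f := DSum (dsumZ_fin a f).

Lemma dsumDA : associative dsumD.
Proof. by move=> f g h; apply: dsumP => i /=; rewrite addrA. Qed.
Lemma dsumDC : commutative dsumD.
Proof. by move=> f g; apply: dsumP => i /=; rewrite addrC. Qed.
Lemma dsumD0 : left_id dsum0 dsumD.
Proof. by move=> f; apply: dsumP => i /=; rewrite add0r. Qed.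
Lemma dsumDN : left_inverse dsum0 dsumN dsumD.
Proof. by move=> f; apply: dsumP => i /=; rewrite addNr. Qed.
HB.instance Definition _ := GRing.isZmodule.Build dsum dsumDA dsumDC dsumD0 dsumDN.

Lemma dsumZA a b f : dsumZ a (dsumZ b f) = dsumZ (a * b) f.
Proof. by apply: dsumP => i /=; rewrite scalerA. Qed.
Lemma dsumZ1 : left_id 1 dsumZ.
Proof. by move=> f; apply: dsumP => i /=; rewrite scale1r. Qed.
Lemma dsumZDr : right_distributive dsumZ +%R.
Proof. by move=> a f g; apply: dsumP => i /=; rewrite scalerDr. Qed.
Lemma dsumZDl f : {morph dsumZ^~ f : a b / a + b}.
Proof. by move=> a b; apply: dsumP => i /=; rewrite scalerDl. Qed.
HB.instance Definition _ :=
  GRing.Zmodule_isLmodule.Build k dsum dsumZA dsumZ1 dsumZDr dsumZDl.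

Definition dsingle (i : I) (v : V i) (j : I) : V j :=
  if i =P j is ReflectT e then ecast j (V j) e v else 0.
Lemma dsingle_fin i v :
  exists r : seq I, forall j, j \notin r -> dsingle (i := i) v j = 0.
Proof.
by exists [:: i] => j; rewrite inE eq_sym /dsingle; case: eqP.
Qed.
Definition dinj i (v : V i) : dsum := DSum (dsingle_fin v).

Lemma dinjE i (v : V i) : dinj v i = v.
Proof.
rewrite /= /dsingle; case: eqP => // e.
by rewrite (Prop_irrelevance e erefl).
Qed.
Lemma dinjN i j (v : V i) : i != j -> dinj v j = 0.
Proof. by rewrite /= /dsingle; case: eqP. Qed.
Lemma dinj_linear i : linear (@dinj i).
Proof.
move=> a u v; apply: dsumP => j; rewrite /= /dsingle.
case: eqP => [e|_]; last by rewrite scaler0 addr0.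
by case: j / e.
Qed.
Lemma dinj_ecast i j (e : i = j) (v : V i) :
  dinj (ecast j (V j) e v) = dinj v.
Proof. by case: j / e. Qed.

(* Only meaningful when every [phi i] is linear, or at least maps 0 to 0: the
   sum then has finite support. *)
Definition dlift (W : lmodType k) (phi : forall i, V i -> W) (f : dsum) : W :=
  \sum_(i \in [set: I]) phi i (f i).

End DirectSum.

Lemma linear_0 (k : fieldType) (U W : lmodType k) (f : U -> W) :
  linear f -> f 0 = 0.
Proof.
by move=> lf; have := lf (-1) 0 0; rewrite scaleN1r oppr0 addr0 scaleN1r addNr.
Qed.
Lemma linear_D (k : fieldType) (U W : lmodType k) (f : U -> W) :
  linear f -> {morph f : u v / u + v}.
Proof. by move=> lf u v; have := lf 1 u v; rewrite !scale1r. Qed.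
Lemma linear_sum (k : fieldType) (U W : lmodType k) (f : U -> W)
    (I : Type) (r : seq I) (c : I -> U) :
  linear f -> f (\sum_(i <- r) c i) = \sum_(i <- r) f (c i).
Proof.
move=> lf; elim: r => [|i r ih]; first by rewrite !big_nil linear_0.
by rewrite !big_cons linear_D // ih.
Qed.

Section DirectSumTheory.
Variables (k : fieldType) (I : choiceType) (V : I -> lmodType k).
Variables (W : lmodType k).
Implicit Types (phi : forall i, V i -> W) (f g : dsum V).

Lemma dsum_supp f :
  exists2 r : seq I, uniq r & forall i, i \notin r -> f i = 0.
Proof.
have [r hr] := dsum_fin f; exists (undup r); first exact: undup_uniq.
by move=> i; rewrite mem_undup => /hr.
Qed.

Lemma dliftE phi f (r : seq I) : (forall i, linear (phi i)) -> uniq r ->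
  (forall i, i \notin r -> f i = 0) -> dlift phi f = \sum_(i <- r) phi i (f i).
Proof.
move=> lphi ur hr; rewrite /dlift (fsbigE r) //=; last first.
  by move=> i _ /hr->; rewrite linear_0.
by apply: eq_bigl => i; rewrite in_setT.
Qed.

Lemma eq_dlift phi psi f : (forall i v, phi i v = psi i v) ->
  dlift phi f = dlift psi f.
Proof. by move=> e; rewrite /dlift; apply: eq_fsbigr => i _; apply: e. Qed.

Lemma dlift_linear phi : (forall i, linear (phi i)) -> linear (dlift phi).
Proof.
move=> lphi a f g; have [r ur hr] := dsum_supp f; have [t ut ht] := dsum_supp g.
have hrt i : i \notin undup (r ++ t) -> f i = 0 /\ g i = 0.
  by rewrite mem_undup mem_cat negb_or => /andP[/hr-> /ht->].
rewrite !(@dliftE _ _ (undup (r ++ t))) ?undup_uniq //;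
  try by move=> i /hrt[e1 e2] /=; rewrite ?e1 ?e2 ?scaler0 ?addr0.
by rewrite scaler_sumr -big_split; apply: eq_bigr => i _; apply: lphi.
Qed.

Lemma dlift_inj phi i (v : V i) : (forall i, linear (phi i)) ->
  dlift phi (dinj v) = phi i v.
Proof.
move=> lphi; rewrite (@dliftE _ _ [:: i]) ?big_seq1 ?dinjE //.
by move=> j; rewrite inE eq_sym => /dinjN->.
Qed.

Lemma dsum_sumE (r : seq I) (c : I -> dsum V) j :
  (\sum_(i <- r) c i) j = \sum_(i <- r) c i j.
Proof. by elim: r => [|i r ih]; rewrite ?big_nil // !big_cons /= ih. Qed.

Lemma dsum_decomp f (r : seq I) : uniq r ->
  (forall i, i \notin r -> f i = 0) -> f = \sum_(i <- r) dinj (f i).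
Proof.
move=> ur hr; apply: dsumP => j; rewrite dsum_sumE.
have [jr|jr] := boolP (j \in r).
  rewrite (bigD1_seq j) //= big1 ?addr0 => [|i ij]; last exact: dinjN.
  exact/esym/dinjE.
rewrite hr // big_seq big1 // => i ir; apply: dinjN.
by apply: contraNneq jr => <-.
Qed.

Lemma dsum_ext (phi psi : dsum V -> W) : linear phi -> linear psi ->
  (forall i (v : V i), phi (dinj v) = psi (dinj v)) -> phi =1 psi.
Proof.
move=> lphi lpsi e f; have [r ur hr] := dsum_supp f.
rewrite (dsum_decomp ur hr) (linear_sum _ _ lphi) (linear_sum _ _ lpsi).
by apply: eq_bigr => i _; apply: e.
Qed.

Lemma dlift_comb (a : k) phi psi f : (forall i, linear (phi i)) ->
  (forall i, linear (psi i)) ->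
  dlift (fun i v => a *: phi i v + psi i v) f = a *: dlift phi f + dlift psi f.
Proof.
move=> lphi lpsi; have [r ur hr] := dsum_supp f.
rewrite !(@dliftE _ _ r) // => [|i b u v].
  by rewrite big_split scaler_sumr.
rewrite lphi lpsi !scalerDr !scalerA mulrC -!addrA; congr (_ + _).
by rewrite addrCA.
Qed.
End DirectSumTheory.

Section Orbit.
Variables (k : fieldType) (G : groupType) (D : lincat k).
Variable F : UMagmaMorphism.type G (autom D).

Definition act_ob1 (x : D) : x = F 1%g x :=
  esym (congr1 (fun A : autom D => A x) (gmulf1 (s := F))).
Definition act_obM (p q : G) (x : D) : F p (F q x) = F (p * q)%g x :=
  esym (congr1 (fun A : autom D => A x) (gmulfM (s := F) p q)).
Definition act_obV (p : G) (x : D) : F p (F p^-1%g x) = x :=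
  etrans (act_obM p p^-1%g x)
    (etrans (congr1 (fun q => F q x) (mulgV p)) (esym (act_ob1 x))).

Definition orbit_hom (x y : D) : lmodType k := dsum (fun p => mor x (F p y)).

Definition orbit_id (x : D) : orbit_hom x x :=
  dinj (V := fun p => mor x (F p x)) (castcod (act_ob1 x) (idm x)).

Definition orbit_comp_homog (x y z : D) (p q : G)
    (g : mor y (F q z)) (f : mor x (F p y)) : mor x (F (p * q)%g z) :=
  castcod (act_obM p q z) (fmap (F p) g \oc f).

(* Bilinear extension of the composition of homogeneous morphisms. *)
Definition orbit_comp (x y z : D) (g : orbit_hom y z) (f : orbit_hom x y) :
    orbit_hom x z :=
  dlift (fun p fp => dlift (fun q gq =>
    dinj (V := fun r => mor x (F r z)) (orbit_comp_homog gq fp)) g) f.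

Lemma ochl x y z p q (g : mor y (F q z)) :
  linear (fun f : mor x (F p y) => orbit_comp_homog g f).
Proof. by move=> a u v; rewrite /orbit_comp_homog comp_linr castcod_linear. Qed.
Lemma ochr x y z p q (f : mor x (F p y)) :
  linear (fun g : mor y (F q z) => orbit_comp_homog g f).
Proof.
move=> a u v; rewrite /orbit_comp_homog.
by rewrite (fmap_linear (functorP (F p))) comp_linl castcod_linear.
Qed.

Lemma orbit_comp_phir x y z p (fp : mor x (F p y)) q :
  linear (fun gq : mor y (F q z) =>
    dinj (V := fun r => mor x (F r z)) (orbit_comp_homog gq fp)).
Proof. by move=> a u v; rewrite ochr dinj_linear. Qed.

Lemma orbit_comp_phil x y z (g : orbit_hom y z) p :
  linear (fun fp : mor x (F p y) => dlift (fun q gq =>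
    dinj (V := fun r => mor x (F r z)) (orbit_comp_homog gq fp)) g).
Proof.
move=> a u v.
rewrite -dlift_comb; try by move=> i; apply: orbit_comp_phir.
by apply: eq_dlift => q w; rewrite ochl dinj_linear.
Qed.

Lemma orbit_comp_linr x y z (g : orbit_hom y z) :
  linear (fun f : orbit_hom x y => orbit_comp g f).
Proof. by apply: dlift_linear => p; apply: orbit_comp_phil. Qed.

Lemma orbit_comp_linl x y z (f : orbit_hom x y) :
  linear (fun g : orbit_hom y z => orbit_comp g f).
Proof.
move=> a u v; rewrite /orbit_comp.
rewrite -dlift_comb; try by move=> i; apply: orbit_comp_phil.
apply: eq_dlift => p fp.
by rewrite (dlift_linear (orbit_comp_phir fp)).
Qed.

Lemma orbit_comp_inj x y z p q (g : mor y (F q z)) (f : mor x (F p y)) :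
  orbit_comp (dinj (V := fun q => mor y (F q z)) g)
             (dinj (V := fun p => mor x (F p y)) f)
  = dinj (V := fun r => mor x (F r z)) (orbit_comp_homog g f).
Proof.
rewrite /orbit_comp dlift_inj; last by move=> i; apply: orbit_comp_phil.
by rewrite dlift_inj //; apply: orbit_comp_phir.
Qed.

Lemma dinj_castcod x z p q (e : p = q) (e' : F p z = F q z)
    (f : mor x (F p z)) :
  dinj (V := fun r => mor x (F r z)) (castcod e' f)
  = dinj (V := fun r => mor x (F r z)) f.
Proof. by subst q; rewrite castcod_id. Qed.

Lemma fmap_actM p q (x y : D) (f : mor x y) :
  fmap (F (p * q)%g) f =
  castdom (act_obM p q x) (castcod (act_obM p q y) (fmap (F p) (fmap (F q) f))).
Proof.
have e : fcomp (F p) (F q) = F (p * q)%g by rewrite gmulfM.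
rewrite (fmap_prefun_eq e) /=.
by rewrite (Prop_irrelevance (congr1 _ e) (act_obM p q x))
           (Prop_irrelevance (congr1 _ e) (act_obM p q y)).
Qed.

Lemma fmap_act1 (x y : D) (f : mor x y) :
  fmap (F 1%g) f = castdom (act_ob1 x) (castcod (act_ob1 y) f).
Proof.
have e : fid D = F 1%g by rewrite gmulf1.
rewrite (fmap_prefun_eq e) /=.
by rewrite (Prop_irrelevance (congr1 _ e) (act_ob1 x))
           (Prop_irrelevance (congr1 _ e) (act_ob1 y)).
Qed.

Lemma orbit_compA x y z w (f : orbit_hom x y) (g : orbit_hom y z)
    (h : orbit_hom z w) :
  orbit_comp h (orbit_comp g f) = orbit_comp (orbit_comp h g) f.
Proof.
apply: (dsum_ext (phi := fun f => orbit_comp h (orbit_comp g f))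
                 (psi := fun f => orbit_comp (orbit_comp h g) f)) => {f}.
- by move=> a u v; rewrite !orbit_comp_linr.
- exact: orbit_comp_linr.
move=> p f.
apply: (dsum_ext (phi := fun g => orbit_comp h (orbit_comp g (dinj f)))
                 (psi := fun g => orbit_comp (orbit_comp h g) (dinj f))) => {g}.
- by move=> a u v; rewrite orbit_comp_linl orbit_comp_linr.
- by move=> a u v; rewrite orbit_comp_linr orbit_comp_linl.
move=> q g.
apply: (dsum_ext (phi := fun h => orbit_comp h (orbit_comp (dinj g) (dinj f)))
  (psi := fun h => orbit_comp (orbit_comp h (dinj g)) (dinj f))) => {h}.
- exact: orbit_comp_linl.
- by move=> a u v; rewrite !orbit_comp_linl.
move=> r h; rewrite !orbit_comp_inj.
have e : F (p * q * r)%g w = F (p * (q * r))%g w by rewrite mulgA.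
rewrite -(dinj_castcod (esym (mulgA p q r)) e).
congr dinj; rewrite /orbit_comp_homog fmap_actM comp_cast.
rewrite comp_castcod fmap_castcod (fmapM (functorP (F p))) comp_castcod compA.
rewrite !castcod_trans; congr (castcod _ _); exact: Prop_irrelevance.
Qed.

Lemma orbit_comp1m x y (f : orbit_hom x y) : orbit_comp (orbit_id y) f = f.
Proof.
apply: (dsum_ext (phi := fun f => orbit_comp (orbit_id y) f) (psi := id)) => //.
  exact: orbit_comp_linr.
move=> p {}f; rewrite orbit_comp_inj.
have e : F (p * 1)%g y = F p y by rewrite mulg1.
rewrite -(dinj_castcod (mulg1 p) e); congr dinj.
rewrite /orbit_comp_homog fmap_castcod (fmap1 (functorP (F p))) comp_castcod.
by rewrite comp1m !castcod_trans castcod_id.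
Qed.

Lemma orbit_compm1 x y (f : orbit_hom x y) : orbit_comp f (orbit_id x) = f.
Proof.
apply: (dsum_ext (phi := fun f => orbit_comp f (orbit_id x)) (psi := id)) => //.
  exact: orbit_comp_linl.
move=> p {}f; rewrite orbit_comp_inj.
have e : F (1 * p)%g y = F p y by rewrite mul1g.
rewrite -(dinj_castcod (mul1g p) e); congr dinj.
rewrite /orbit_comp_homog fmap_act1 comp_cast compm1.
by rewrite !castcod_trans castcod_id.
Qed.

Definition orbit_lincat : lincat k :=
  LinCat orbit_compA orbit_comp1m orbit_compm1 orbit_comp_linl orbit_comp_linr.

Definition orbit_homog (p : G) (x y : orbit_lincat) (f : mor x y) : Prop :=
  forall q, q != p -> (f : orbit_hom x y) q = 0.

Lemma orbit_homogP p (x y : orbit_lincat) (f : mor x y) :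
  orbit_homog p f -> f = dinj ((f : orbit_hom x y) p).
Proof.
move=> hf; apply: dsumP => q; have [->|qp] := eqVneq q p.
  by rewrite dinjE.
by rewrite hf // dinjN // eq_sym.
Qed.

Lemma orbit_homog_inj p (x y : D) (v : mor x (F p y)) :
  @orbit_homog p x y (dinj (V := fun p => mor x (F p y)) v).
Proof. by move=> q qp; rewrite dinjN // eq_sym. Qed.

Lemma orbit_homog0 p (x y : orbit_lincat) : orbit_homog p (0 : mor x y).
Proof. by []. Qed.

Lemma orbit_homog_lin p (x y : orbit_lincat) a (f g : mor x y) :
  orbit_homog p f -> orbit_homog p g -> orbit_homog p (a *: f + g).
Proof. by move=> hf hg q qp /=; rewrite hf // hg // scaler0 addr0. Qed.

Lemma orbit_homog_span (x y : orbit_lincat) (f : mor x y) :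
  exists (r : seq G) (c : G -> mor x y),
    [/\ uniq r, forall p, orbit_homog p (c p) & f = \sum_(p <- r) c p].
Proof.
have [r ur hr] := dsum_supp (f : orbit_hom x y).
exists r, (fun p => dinj ((f : orbit_hom x y) p)); split=> //.
  by move=> p; apply: orbit_homog_inj.
exact: dsum_decomp.
Qed.

Lemma orbit_homog_indep (x y : orbit_lincat) (r : seq G) (c : G -> mor x y) :
  uniq r -> (forall p, orbit_homog p (c p)) -> \sum_(p <- r) c p = 0 ->
  forall p, p \in r -> c p = 0.
Proof.
move=> ur hc c0 p pr; rewrite (orbit_homogP (hc p)).
have -> : (c p : orbit_hom x y) p = (\sum_(q <- r) c q : orbit_hom x y) p.
  rewrite dsum_sumE (bigD1_seq p) //= big1 ?addr0 // => q qp.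
  by apply: hc; rewrite eq_sym.
by rewrite c0 (linear_0 (dinj_linear (i := p))).
Qed.

Lemma orbit_homog1 (x : orbit_lincat) : orbit_homog 1%g (idm x).
Proof. exact: orbit_homog_inj. Qed.

Lemma orbit_homogM p q (x y z : orbit_lincat) (f : mor x y) (g : mor y z) :
  orbit_homog p f -> orbit_homog q g -> orbit_homog (p * q)%g (g \oc f).
Proof.
move=> /orbit_homogP-> /orbit_homogP->.
by rewrite /= orbit_comp_inj; apply: orbit_homog_inj.
Qed.

Definition orbit_cat : hom_graded k G :=
  HomGraded orbit_homog0 orbit_homog_lin orbit_homog_span orbit_homog_indep
    orbit_homog1 orbit_homogM.

Variables (chi : character G k) (S : prefunctor D D).

(* Linear extension of f |-> s^p_x \oc S f, for f of degree p. *)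
Definition orbit_serre_fun (s : forall p y, mor (S (F p y)) (F p (S y))) :
    prefunctor orbit_cat orbit_cat :=
  @PreFunctor k orbit_cat orbit_cat S (fun w x (f : orbit_hom w x) =>
    dlift (W := orbit_hom (S w) (S x)) (fun p fp =>
      dinj (V := fun p => mor (S w) (F p (S x))) (s p x \oc fmap S fp)) f).

(* The degree p component of f pairs with the degree -p component of g. *)
Definition orbit_serre_pairing
    (kappa : forall x y : D, mor x y -> mor y (S x) -> k)
    (u v : D) (f : orbit_hom u v) (g : orbit_hom v (S u)) : k :=
  \sum_(p \in [set: G]) chi p *
    kappa u (F p v) (f p) (castcod (act_obV p (S u)) (fmap (F p) (g p^-1%g))).

End Orbit.
Arguments orbit_serre_fun {k G D} F S s.
Arguments orbit_serre_pairing {k G D} F chi S kappa.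

(* Main.v *)
Require Import Defs.
From HB Require Import structures.
From mathcomp Require Import all_boot all_order all_algebra.
From mathcomp Require Import boolp classical_sets functions cardinality fsbigop.

(** Everything on the orbit category is determined by its values on homogeneous
    morphisms, and on these each required property reduces to a property of
    (S, kappa) in D. Writing s p = chi p *: zeta p, three ideas carry the
    reduction.

    Functoriality of S on the orbit category amounts to the naturality of s p
    together with the relations s 1 = 1 and
    s (p * q) = F p (s q) \oc s p (F q) ([s1], [sM]). The character takes
    care of the scalars in these relations. For zeta they follow from uniqueness: an
    invertible family zeta_E is determined by the compatibility of kappa with E
    ([mate_unique]), because kappa is nondegenerate also in its second variable
    ([serre_separates]), and the right hand sides have that compatibility
    ([mate_id], [mate_comp]).

    The functor is an autoequivalence because it is fully faithful and
    essentially surjective ([orbit_serre_ff]): in degree p it is S followed by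
    the isomorphism s p, and isomorphisms of D persist in the orbit category.

    The pairing couples degree p only with degree p^-1, where up to the nonzero
    scalar chi p and the bijection [untwist] it is the pairing kappa of D. So
    graded functionals are represented degree by degree ([pairing_inj],
    [pairing_surj]). The first duality identity is the one in D with an extra
    factor coming from chi (p * q) = chi p * chi q ([pairing_compl]). The second
    one in addition trades F p g for g, which is the defining property of zeta p;
    the factor chi p contained in s p makes up for the difference between chi q
    and chi (p * q) ([pairing_compr]). *)

Set Implicit Arguments.
Unset Strict Implicit.
Unset Printing Implicit Defensive.

(* The order makes [compA] the associativity of composition of morphisms. *)
Import GRing.Theory Defs.
Local Open Scope ring_scope.

(** * Autoequivalences as fully faithful and essentially surjective functors *)
Section LinearCategories.
Variable k : fieldType.

Definition inverse_pair (C : lincat k) (x y : C) (a : mor x y) (b : mor y x) :=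
  b \oc a = idm x /\ a \oc b = idm y.

Definition fully_faithful (C D : lincat k) (S : prefunctor C D) :=
  forall x y (g : mor (S x) (S y)), exists! f : mor x y, fmap S f = g.

Definition ess_surjective (C D : lincat k) (S : prefunctor C D) :=
  forall y : D, exists x, exists a : mor (S x) y, exists b,
    inverse_pair a b.

Lemma ff_inj (C D : lincat k) (S : prefunctor C D) x y (f g : mor x y) :
  fully_faithful S -> fmap S f = fmap S g -> f = g.
Proof.
by move=> /(_ x y (fmap S g)) [h [_ hu]] e; rewrite -(hu f) // -(hu g).
Qed.

Lemma comp_can_l (C : lincat k) (x y z : C) (a : mor y z) b (f g : mor x y) :
  inverse_pair a b -> a \oc f = a \oc g -> f = g.
Proof. by case=> e _ h; rewrite -(comp1m f) -(comp1m g) -e -!compA h. Qed.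

Lemma comp_can_r (C : lincat k) (x y z : C) (a : mor x y) b (f g : mor y z) :
  inverse_pair a b -> f \oc a = g \oc a -> f = g.
Proof. by case=> _ e h; rewrite -(compm1 f) -(compm1 g) -e !compA h. Qed.

(** With T a quasi-inverse, T S is isomorphic to the identity, so S is
    faithful; T is faithful for the same reason. A preimage of g is found by
    transporting T g along T S = 1 and is recognised after applying T. *)
Lemma autoequivalence_ff (C : lincat k) (S : prefunctor C C) :
  is_autoequivalence S -> fully_faithful S.
Proof.
case=> -[S1 SM SL] [T [[eta [etaN etaI]] [eps [epsN epsI]]]].
have T_inj x y (f g : mor x y) : fmap T f = fmap T g -> f = g.
  move=> e; have [b /comp_can_r] := epsI x; apply.
  by have := epsN _ _ f; rewrite /= e (epsN _ _ g).
have S_inj x y (f g : mor x y) : fmap S f = fmap S g -> f = g.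
  move=> e; have [b /comp_can_l] := etaI y; apply.
  by rewrite (etaN _ _ f) /= e -(etaN _ _ g).
move=> x y g; have [b [ba ab]] := etaI y; have [c [ca ac]] := etaI x.
exists (b \oc fmap T g \oc eta x); split; last first.
  move=> f e; apply/S_inj/T_inj.
  by rewrite -e -compA -(etaN _ _ f) compA ba comp1m.
apply: T_inj; apply: (comp_can_r (conj ca ac)).
by rewrite -(etaN _ _ _) /= -compA compA ab comp1m.
Qed.

Lemma autoequivalence_ess_surj (C : lincat k) (S : prefunctor C C) :
  is_autoequivalence S -> ess_surjective S.
Proof.
case=> _ [T [_ [eps [_ epsI]]]] y; have [b hb] := epsI y.
by exists (T y), (eps y), b.
Qed.

(** The quasi-inverse chooses an isomorphism a y : S (T y) -> y for every y,
    and sends f to the preimage under S of its conjugate by these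
    isomorphisms. *)
Lemma ff_ess_surj_autoequivalence (C : lincat k) (S : prefunctor C C) :
  is_functor S -> fully_faithful S -> ess_surjective S -> is_autoequivalence S.
Proof.
move=> SF Sff Ses; split=> //; have [S1 SM SL] := SF.
pose T0 y := sval (cid (Ses y)); pose Ta y := cid (svalP (cid (Ses y))).
pose a y : mor (S (T0 y)) y := sval (Ta y).
pose Tb y := cid (svalP (Ta y)).
pose b y : mor y (S (T0 y)) := sval (Tb y).
have ab y : inverse_pair (a y) (b y) by exact: svalP (Tb y).
pose lift x y (g : mor (S x) (S y)) := sval (cid (Sff x y g)).
have liftK x y (g : mor (S x) (S y)) : fmap S (lift x y g) = g.
  by rewrite /lift; case: (cid _) => f [].
have inj x y (f g : mor x y) : fmap S f = fmap S g -> f = g by exact: ff_inj.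
pose T1 := @PreFunctor k C C T0 (fun x y f => lift _ _ (b y \oc f \oc a x)).
have TF : is_functor T1.
  split=> /=.
  - by move=> x; apply: inj; rewrite liftK compm1 S1; case: (ab x).
  - move=> x y z f g; apply: inj; rewrite SM !liftK.
    rewrite -!compA; congr (_ \oc (_ \oc _)).
    by rewrite compA; case: (ab y) => _ ->; rewrite comp1m.
  - move=> x y c f g; apply: inj.
    by rewrite SL !liftK comp_linr comp_linl.
exists (Functor TF); split.
- exists (fun x => lift _ _ (b (S x))); split=> /= [x y f|x].
    apply: inj; rewrite !SM !liftK -compA.
    by case: (ab (S x)) => _ ->; rewrite compm1.
  exists (lift _ _ (a (S x))).
  have [e1 e2] := ab (S x).
  by split; apply: inj; rewrite SM !liftK S1.
- exists a; split=> /= [x y f|x]; last by exists (b x); exact: ab.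
  by rewrite liftK -compA compA; case: (ab y) => _ ->; rewrite comp1m.
Qed.
End LinearCategories.

(** * Strict automorphisms and transport along equalities of objects *)
Section Automorphisms.
Variables (k : fieldType) (D : lincat k).
Implicit Type A : autom D.

Lemma castdom_inj (x x' y : D) (e : x = x') : injective (@castdom k D x x' y e).
Proof. by subst x'. Qed.

Lemma castcod_inj (x y y' : D) (e : y = y') : injective (@castcod k D x y y' e).
Proof. by subst y'. Qed.

Lemma comp_castcodr (x y y' z : D) (e : y = y') (g : mor y' z) (f : mor x y) :
  g \oc castcod e f = castdom (esym e) g \oc f.
Proof. by subst y'. Qed.

Lemma castcod_castdom (x x' y y' : D) (e : x = x') (e' : y = y') (f : mor x y) :
  castcod e' (castdom e f) = castdom e (castcod e' f).
Proof. by subst x' y'. Qed.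

Lemma castdom_linear (x x' y : D) (e : x = x') :
  linear (fun f : mor x y => castdom e f).
Proof. by subst x'. Qed.

Lemma autom_fmapK A (x y : D) (f : mor x y) :
  castdom (autom_obK A x) (castcod (autom_obK A y)
    (fmap (autom_inv A) (fmap A f))) = f.
Proof.
by rewrite [RHS](fmap_prefun_eq (autom_funK A)).
Qed.

Lemma autom_fmap_inj A (x y : D) : injective (fun f : mor x y => fmap A f).
Proof. by move=> f g /= e; rewrite -(autom_fmapK A f) e autom_fmapK. Qed.

Lemma autom_ff A : fully_faithful A.
Proof.
move=> x y u.
exists (castdom (autom_obK A x)
  (castcod (autom_obK A y) (fmap (autom_inv A) u))).
split=> [|f <-]; last exact: autom_fmapK.
apply: (@autom_fmap_inj (autom_invg A)) => /=.
apply: (@castcod_inj _ _ _ (autom_obK A y)).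
by apply: (@castdom_inj _ _ _ (autom_obK A x)); apply: (autom_fmapK A).
Qed.
End Automorphisms.

(** * The canonical isomorphism of a Serre functor with an automorphism *)
Section SerreMates.
Variables (k : fieldType) (D : lincat k) (S : prefunctor D D).
Variable kappa : forall x y : D, mor x y -> mor y (S x) -> k.
Hypothesis hS : is_serre S kappa.

Lemma serre_functor : is_functor S.
Proof. by case: (serre_autoeq hS). Qed.

Lemma serre_ff : fully_faithful S.
Proof. exact: autoequivalence_ff (serre_autoeq hS). Qed.

Lemma dual_iso_inj (V W : lmodType k) (b : V -> W -> k) v v' :
  dual_iso b -> b v = b v' -> v = v'.
Proof.
by case=> _ lb /(_ (b v') (lb v')) [w [_ hw]] e; rewrite -(hw v) // -(hw v').
Qed.

(** Separation of the second variable follows from that of the first: if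
    w = S f \oc b for an isomorphism b : y -> S y', then
    kappa g w = kappa (g \oc f) b = kappa f (b \oc g), and b \oc g runs over
    all of the morphisms x -> S y' that f is paired with. *)
Lemma serre_separates (x y : D) (w w' : mor y (S x)) :
  (forall g : mor x y, kappa g w = kappa g w') -> w = w'.
Proof.
move=> e.
have [y' [a [b [ba ab]]]] := autoequivalence_ess_surj (serre_autoeq hS) y.
have [f [fE _]] := serre_ff (w \oc a); have [f' [f'E _]] := serre_ff (w' \oc a).
suff ff' : f = f'.
  by rewrite -(compm1 w) -(compm1 w') -ab !compA -fE -f'E ff'.
apply: (dual_iso_inj (serre_dual hS y' x)); apply/funext => u.
have [c uE] : exists c, u = b \oc c.
  by exists (a \oc u); rewrite compA ba comp1m.
by rewrite uE -!(serre_compl hS) !(serre_compr hS) fE f'E -!compA ab !compm1.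
Qed.

(** The characterisation of zeta_E with the inverse of E eliminated: it makes
    sense for every endofunctor E, which lets the canonical isomorphisms of
    equal or composite functors be compared before any transport of objects
    enters. *)
Definition serre_mate (E : functor D D)
    (z : forall y, mor (S (E y)) (E (S y))) :=
  forall x y (e : mor x y) (v : mor y (S x)) (u : mor (E y) (S (E x))),
    z x \oc u = fmap E v -> kappa (fmap E e) u = kappa e v.

Lemma kappa_cast (x y y' : D) (e : y = y') (f : mor x y) (u : mor y (S x)) :
  kappa (castcod e f) (castdom e u) = kappa f u.
Proof. by subst y'. Qed.

Lemma is_zeta_mate (A : autom D) z :
  is_zeta S kappa A z -> serre_mate (E := A) z.
Proof.
case=> _ zP x y e v u zu.
rewrite zP zu -(kappa_cast (autom_obK A y)) castcod_castdom autom_fmapK.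
by rewrite -castcod_castdom castcod_castdom autom_fmapK.
Qed.

(** With b inverse to z y, the endomorphism z' y \oc b is E m for some m; pairing
    b with E g in the two ways gives kappa g m = kappa g 1 for all g. *)
Lemma mate_unique (E : functor D D) z z' y : fully_faithful E ->
  serre_mate (E := E) z -> serre_mate (E := E) z' ->
  (exists b, inverse_pair (z y) b) -> z y = z' y.
Proof.
move=> Eff zP z'P [b [bz zb]].
have [m [mE _]] := Eff _ _ (z' y \oc b).
suff m1 : m = idm (S y).
  by rewrite -[RHS]compm1 -bz compA -mE m1 (fmap1 (functorP E)) comp1m.
apply: serre_separates => g; rewrite -(z'P _ _ g m b) ?mE //.
by apply: zP; rewrite zb (fmap1 (functorP E)).
Qed.

Lemma mate_id : serre_mate (E := fid D) (fun y => idm (S y)).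
Proof. by move=> x y e v u; rewrite comp1m => ->. Qed.

Lemma mate_comp (E E' : functor D D) z z' : fully_faithful E ->
  serre_mate (E := E) z -> serre_mate (E := E') z' ->
  serre_mate (E := fcomp E E') (fun y => fmap E (z' y) \oc z (E' y)).
Proof.
move=> Eff zP z'P x y e v u; rewrite -compA.
have [u' [zu _]] := Eff _ _ (z (E' x) \oc u).
rewrite -zu -(fmapM (functorP E)) => h; rewrite (zP _ _ _ u') //.
by apply: z'P; exact: (ff_inj Eff h).
Qed.

(** Functoriality of F only gives equalities such as F p F q = F (p * q), so
    uniqueness is needed up to transport along an equality of functors. *)
Lemma mate_castE (E E' : functor D D) z z' y (e : E = E')
    (e1 : S (E y) = S (E' y)) (e2 : E (S y) = E' (S y)) :
  fully_faithful E -> serre_mate (E := E) z -> serre_mate (E := E') z' ->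
  (exists b, inverse_pair (z' y) b) -> z' y = castdom e1 (castcod e2 (z y)).
Proof.
subst E' => Eff zP z'P h.
by rewrite castcod_id castdom_id; apply: mate_unique.
Qed.
End SerreMates.

(** * Homogeneous morphisms of the orbit category *)
Section Orbit.
Variables (k : fieldType) (G : groupType) (D : lincat k).
Variable F : UMagmaMorphism.type G (autom D).
Implicit Types (p q r : G) (x y z w u v : D).

Lemma actM_fcomp p q : fcomp (F p) (F q) = F (p * q)%g.
Proof. by rewrite gmulfM. Qed.

Lemma act1_fid : fid D = F 1%g.
Proof. by rewrite gmulf1. Qed.

Definition homor p x y (f : mor x (F p y)) : @mor k (orbit_cat F) x y :=
  dinj (V := fun p => mor x (F p y)) f.

Definition component p x y (f : @mor k (orbit_cat F) x y) : mor x (F p y) :=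
  dsum_fun f p.

Lemma componentP x y (f g : @mor k (orbit_cat F) x y) :
  (forall p, component p f = component p g) -> f = g.
Proof. exact: dsumP. Qed.

Lemma component_homor p x y (f : mor x (F p y)) : component p (homor f) = f.
Proof. exact: (dinjE (V := fun p => mor x (F p y))). Qed.

Lemma component_homorN p q x y (f : mor x (F p y)) :
  p != q -> component q (homor f) = 0.
Proof. exact: (dinjN (V := fun p => mor x (F p y))). Qed.

Lemma component_homor_cast p q x y (e : p = q) (f : mor x (F p y)) :
  component q (homor f) = castcod (congr1 (fun r => F r y) e) f.
Proof. by subst q; rewrite castcod_id component_homor. Qed.

Lemma homogP p x y (f : @mor k (orbit_cat F) x y) :
  homog p f -> f = homor (component p f).
Proof. exact: (orbit_homogP (F := F)). Qed.

Lemma homog_homor p x y (f : mor x (F p y)) : homog p (homor f).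
Proof. exact: (@orbit_homog_inj k G D F p x y f). Qed.

Lemma act_objMV p q x : F p (F q (F (p * q)^-1%g x)) = x.
Proof. by rewrite act_obM act_obV. Qed.

Lemma actMV_fid p q : fid D = fcomp (F p) (fcomp (F q) (F (p * q)^-1%g)).
Proof. by rewrite !actM_fcomp mulgA mulgV gmulf1. Qed.

(** Removes the threefold twist that appears in the second duality identity, where
    the degrees of the three morphisms multiply to 1. *)
Lemma fmap_actMV p q x y (f : mor x y)
    (ey : F p (F q (F (p * q)^-1%g y)) = y)
    (ex : x = F p (F q (F (p * q)^-1%g x))) :
  castcod ey (fmap (F p) (fmap (F q) (fmap (F (p * q)^-1%g) f))) = castdom ex f.
Proof.
rewrite -[fmap (F p) _]/(fmap (fcomp (F p) (fcomp (F q) (F (p * q)^-1%g))) f).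
rewrite (fmap_prefun_eq (actMV_fid p q)) castcod_castdom.
rewrite castcod_trans castcod_id.
by congr (castdom _ _); exact: Prop_irrelevance.
Qed.

Lemma homor_linear p x y : linear (@homor p x y).
Proof. exact: (@dinj_linear k G (fun p => mor x (F p y)) p). Qed.

Lemma homor_comp p q x y z (f : mor x (F p y)) (g : mor y (F q z)) :
  homor g \oc homor f = homor (orbit_comp_homog g f).
Proof. exact: (@orbit_comp_inj k G D F x y z p q g f). Qed.

Lemma homor_ext x y (W : lmodType k) (phi psi : @mor k (orbit_cat F) x y -> W) :
  linear phi -> linear psi ->
  (forall p (f : mor x (F p y)), phi (homor f) = psi (homor f)) -> phi =1 psi.
Proof. exact: (@dsum_ext k G (fun p => mor x (F p y)) W). Qed.

Lemma homor_castcod p q x z (e : p = q) (e' : F p z = F q z)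
    (f : mor x (F p z)) : homor (castcod e' f) = homor f.
Proof. exact: dinj_castcod. Qed.

(** Sends isomorphisms of D to isomorphisms of the orbit category of degree 1, the
    neutral element. *)
Definition orbit_incl x y (f : mor x y) : @mor k (orbit_cat F) x y :=
  homor (castcod (act_ob1 F y) f).

Lemma orbit_incl_comp x y z (f : mor x y) (g : mor y z) :
  orbit_incl g \oc orbit_incl f = orbit_incl (g \oc f).
Proof.
have e : F (1 * 1)%g z = F 1%g z by rewrite mul1g.
rewrite homor_comp -(homor_castcod (mul1g 1%g) e); congr homor.
rewrite /orbit_comp_homog fmap_act1 comp_cast !castcod_trans comp_castcod.
by rewrite !castcod_trans; congr (castcod _ _); exact: Prop_irrelevance.
Qed.

(** This bijection identifies the degree p^-1 part of the hom space from y to x in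
    the orbit category with a hom space of D: it is the map whose dual is the
    second arrow in the definition of the degree p component of the pairing. *)
Definition untwist p x y (f : mor y (F p^-1%g x)) : mor (F p y) x :=
  castcod (act_obV F p x) (fmap (F p) f).

Lemma untwist_linear p x y : linear (@untwist p x y).
Proof.
move=> a f g.
by rewrite /untwist (fmap_linear (functorP (F p))) castcod_linear.
Qed.

Lemma untwist_surj p x y (h : mor (F p y) x) : exists f, untwist f = h.
Proof.
have [f [fE _]] := @autom_ff _ _ (F p) _ _ (castcod (esym (act_obV F p x)) h).
by exists f; rewrite /untwist fE castcod_trans castcod_id.
Qed.

Lemma untwist_inj p x y : injective (@untwist p x y).
Proof. by move=> f g /castcod_inj/autom_fmap_inj. Qed.

Lemma untwistM p q x y (f : mor y (F (p * q)^-1%g x)) e :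
  untwist f = castdom (act_obM F p q y) (castcod e (fmap (F p) (fmap (F q) f))).
Proof.
rewrite /untwist fmap_actM castcod_castdom castcod_trans; congr castdom.
by congr (castcod _ _); exact: Prop_irrelevance.
Qed.

End Orbit.

Lemma linear_Z (k : fieldType) (U V : lmodType k) (f : U -> V) a u :
  linear f -> f (a *: u) = a *: f u.
Proof. by move=> lf; rewrite -[a *: u]addr0 lf linear_0 ?addr0. Qed.

Lemma char1 (G : groupType) (k : fieldType) (chi : character G k) : chi 1%g = 1.
Proof.
by apply: (mulfI (char_neq0 chi 1%g)); rewrite -charM mulg1 mulr1.
Qed.

(** * The cocycle relations of an equivariant Serre structure *)
Section EquivariantSerre.
Variables (k : fieldType) (G : groupType) (chi : character G k) (D : lincat k).
Variable F : UMagmaMorphism.type G (autom D).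
Variable S : prefunctor D D.
Variable s : forall p (y : D), mor (S (F p y)) (F p (S y)).
Variable kappa : forall x y : D, mor x y -> mor y (S x) -> k.
Hypothesis hS : is_equivariant_serre chi F S s kappa.
Implicit Types (p q r : G) (x y z w u v : D).

Let hk : is_serre S kappa. Proof. by case: hS. Qed.
Let SF := serre_functor hk.

Lemma compZl x y z a (g : mor y z) (f : mor x y) :
  (a *: g) \oc f = a *: (g \oc f).
Proof. exact: linear_Z (comp_linl f). Qed.

Lemma compZr x y z a (g : mor y z) (f : mor x y) :
  g \oc (a *: f) = a *: (g \oc f).
Proof. exact: linear_Z (comp_linr g). Qed.

Definition zeta p y : mor (S (F p y)) (F p (S y)) := (chi p)^-1 *: s p y.

Lemma zetaP p : is_zeta S kappa (F p) (zeta p).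
Proof.
have [_ /(_ p) [z [hz sE]]] := hS.
suff -> : zeta p = z by [].
apply: functional_extensionality_dep => y.
by rewrite /zeta sE scalerA mulVf ?scale1r ?char_neq0.
Qed.

Lemma s_zeta p y : s p y = chi p *: zeta p y.
Proof. by rewrite /zeta scalerA divff ?scale1r ?char_neq0. Qed.

Lemma zeta_iso p y : exists b, inverse_pair (zeta p y) b.
Proof. by case: (zetaP p) => -[_ /(_ y)]. Qed.

Lemma s_iso p y : exists b, inverse_pair (s p y) b.
Proof.
have [b [bz zb]] := zeta_iso p y; exists ((chi p)^-1 *: b).
by split; rewrite s_zeta compZl compZr scalerA ?bz ?zb ?divff ?mulVf ?scale1r
  ?char_neq0.
Qed.

Lemma s_natural p x y (f : mor x y) :
  s p y \oc fmap S (fmap (F p) f) = fmap (F p) (fmap S f) \oc s p x.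
Proof.
rewrite !s_zeta compZl compZr; congr (_ *: _).
by case: (zetaP p) => -[/(_ x y f)].
Qed.

(** The identity is a mate of the identity functor, and chi is 1 at the neutral
    element. *)
Lemma s1 y : s 1%g y =
  castdom (congr1 S (act_ob1 F y)) (castcod (act_ob1 F (S y)) (idm (S y))).
Proof.
rewrite s_zeta char1 scale1r.
apply: (mate_castE hk (E' := F 1%g) (act1_fid F) (congr1 S (act_ob1 F y))
  (act_ob1 F (S y)) _ (mate_id kappa) (is_zeta_mate (zetaP 1%g))
  (zeta_iso 1%g y)).
by move=> a b f; exists f; split=> // f' ->.
Qed.

(** This cocycle relation is what makes the functor on the orbit category respect
    composition. For zeta it holds because both sides are mates of
    F p F q = F (p * q); the scalars match because chi is multiplicative. *)
Lemma sM p q y : s (p * q)%g y =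
  castdom (congr1 S (act_obM F p q y)) (castcod (act_obM F p q (S y))
    (fmap (F p) (s q y) \oc s p (F q y))).
Proof.
rewrite !s_zeta charM.
rewrite (linear_Z _ _ (@fmap_linear _ _ _ _ (functorP (F p)) _ _)).
rewrite compZl compZr scalerA.
rewrite (mate_castE hk (E' := F (p * q)%g) (actM_fcomp F p q)
  (congr1 S (act_obM F p q y)) (act_obM F p q (S y)) _
  (mate_comp (@autom_ff _ _ (F p)) (is_zeta_mate (zetaP p))
     (is_zeta_mate (zetaP q)))
  (is_zeta_mate (zetaP (p * q)%g)) (zeta_iso (p * q)%g y)).
  rewrite (linear_Z _ _ (castcod_linear _)).
  by rewrite (linear_Z _ _ (castdom_linear _)) [chi p * _]mulrC.
rewrite actM_fcomp; exact: autom_ff.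
Qed.

(** * The Serre functor of the orbit category *)
Local Notation SC := (orbit_serre_fun F S s).

Lemma serre_component_linear p x y :
  linear (fun f : mor x (F p y) => homor (s p y \oc fmap S f)).
Proof. by move=> a f g; rewrite (fmap_linear SF) comp_linr homor_linear. Qed.

Lemma orbit_serre_homor p x y (f : mor x (F p y)) :
  fmap SC (homor f) = homor (s p y \oc fmap S f).
Proof.
apply: (dlift_inj (phi := fun p fp => homor (s p y \oc fmap S fp))).
by move=> q; apply: serre_component_linear.
Qed.

Lemma orbit_serre_linear x y :
  linear (fun f : @mor k (orbit_cat F) x y => fmap SC f).
Proof.
apply: (dlift_linear (phi := fun p fp => homor (s p y \oc fmap S fp))).
by move=> q; apply: serre_component_linear.
Qed.

Lemma component_linear p x y :
  linear (fun f : @mor k (orbit_cat F) x y => component p f).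
Proof. by []. Qed.

(** The functor acts separately on each homogeneous component, so that full
    faithfulness can be checked one degree at a time. *)
Lemma component_serre p x y (f : @mor k (orbit_cat F) x y) :
  component p (fmap SC f) = s p y \oc fmap S (component p f).
Proof.
apply: (homor_ext (phi := fun f => component p (fmap SC f))
  (psi := fun f => s p y \oc fmap S (component p f))) => {f}.
- by move=> a f g; rewrite orbit_serre_linear component_linear.
- by move=> a f g; rewrite component_linear (fmap_linear SF) comp_linr.
move=> q f; rewrite orbit_serre_homor; have [<-|qp] := eqVneq q p.
  by rewrite !component_homor.
rewrite !component_homorN //.
by rewrite (linear_0 (@fmap_linear _ _ _ _ SF _ _)) (linear_0 (comp_linr _)).
Qed.

Lemma orbit_serre_functor : is_functor SC.
Proof.
have [S1 SM _] := SF; split; last exact: orbit_serre_linear.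
- move=> x; rewrite [LHS]orbit_serre_homor; congr homor.
  by rewrite s1 fmap_castcod comp_cast S1 comp_castcod comp1m.
move=> x y z f g.
apply: (homor_ext (phi := fun f => fmap SC (g \oc f))
  (psi := fun f => fmap SC g \oc fmap SC f)) => {f}.
- by move=> a f f'; rewrite comp_linr orbit_serre_linear.
- by move=> a f f'; rewrite orbit_serre_linear comp_linr.
move=> p f.
refine (homor_ext (F := F) (x := y) (y := z)
  (W := @mor k (orbit_cat F) (S x) (S z))
  (phi := fun g => fmap SC (g \oc homor (F := F) f))
  (psi := fun g => fmap SC g \oc fmap SC (homor (F := F) f)) _ _ _ _) => {g}.
- by move=> a g g'; rewrite comp_linl orbit_serre_linear.
- by move=> a g g'; rewrite orbit_serre_linear comp_linl.
move=> q g; rewrite homor_comp !orbit_serre_homor homor_comp; congr homor.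
rewrite /orbit_comp_homog sM fmap_castcod comp_cast SM (fmapM (functorP (F p))).
rewrite comp_castcod -!compA; congr (castcod _ (_ \oc _)).
by rewrite !compA s_natural.
Qed.

Lemma serre_component_bij p x y (g : mor (S x) (F p (S y))) :
  exists! f, s p y \oc fmap S f = g.
Proof.
have [b bP] := s_iso p y; have [f [fE fu]] := serre_ff hk (b \oc g).
case: bP => bs sb; exists f; split=> [|f' f'E].
  by rewrite fE compA sb comp1m.
by apply: fu; rewrite -f'E compA bs comp1m.
Qed.

(** The preimage of g is assembled from the preimages of its components, each of
    them unique by [serre_component_bij]; uniqueness also forces the preimage of
    a zero component to vanish, so the support stays finite. *)
Lemma orbit_serre_ff : fully_faithful SC.
Proof.
move=> x y g.
pose f p := sval (cid (serre_component_bij (component p g))).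
have [fE fu] : (forall p, s p y \oc fmap S (f p) = component p g) /\
    (forall p f', s p y \oc fmap S f' = component p g -> f p = f').
  split=> p; rewrite /f; case: (cid _) => /= h [hE hu]; [exact: hE|exact: hu].
have [r hr] := dsum_fin g.
have f_fin : exists r : seq G, forall p, p \notin r -> f p = 0.
  exists r => p /hr gp; apply: fu; rewrite /component gp.
  by rewrite (linear_0 (@fmap_linear _ _ _ _ SF _ _)) (linear_0 (comp_linr _)).
exists (DSum f_fin : @mor k (orbit_cat F) x y); split.
  by apply: componentP => p; rewrite component_serre; apply: fE.
move=> h hE; apply: componentP => p; apply: fu.
by rewrite -hE component_serre.
Qed.

(** Essential surjectivity comes from D, since the objects are the same and
    [orbit_incl] preserves isomorphisms. *)
Lemma orbit_serre_autoequivalence : is_autoequivalence SC.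
Proof.
apply: ff_ess_surj_autoequivalence orbit_serre_functor orbit_serre_ff _ => y.
have [x [a [b [ba ab]]]] := autoequivalence_ess_surj (serre_autoeq hk) y.
exists x, (orbit_incl F a), (orbit_incl F b).
by split; rewrite orbit_incl_comp ?ba ?ab.
Qed.

(** * The pairing on the orbit category *)
Local Notation KC := (orbit_serre_pairing F chi S kappa _ _).

Lemma kappa_linl x y (u : mor y (S x)) : scalar (fun f : mor x y => kappa f u).
Proof. by case: (serre_dual hk x y). Qed.

Lemma kappa_linr x y (f : mor x y) : scalar (kappa f).
Proof. by case: (serre_dual hk x y). Qed.

Lemma kappa0l x y (u : mor y (S x)) : kappa (0 : mor x y) u = 0.
Proof. exact: (linear_0 (W := k^o) (kappa_linl u)). Qed.

Lemma kappa0r x y (f : mor x y) : kappa f (0 : mor y (S x)) = 0.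
Proof. exact: (linear_0 (W := k^o) (kappa_linr f)). Qed.

Lemma pairing_component_linear p u v (g : @mor k (orbit_cat F) v (S u)) :
  linear (fun f : mor u (F p v) =>
    chi p * kappa f (untwist (component p^-1%g g)) : k^o).
Proof.
by move=> a f f'; rewrite kappa_linl mulrDr mulrCA.
Qed.

Lemma pairing_linl u v (g : @mor k (orbit_cat F) v (S u)) :
  scalar (fun f : @mor k (orbit_cat F) u v => KC f g).
Proof.
exact: (dlift_linear (W := k^o) (phi := fun p (fp : mor u (F p v)) =>
  chi p * kappa fp (untwist (component p^-1%g g)))
  (fun p => @pairing_component_linear p u v g)).
Qed.

Lemma pairing_homorl p u v (f : mor u (F p v))
    (g : @mor k (orbit_cat F) v (S u)) :
  KC (homor f) g = chi p * kappa f (untwist (component p^-1%g g)).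
Proof.
apply: (dlift_inj (W := k^o) (phi := fun p (fp : mor u (F p v)) =>
    chi p * kappa fp (untwist (component p^-1%g g)))) => q.
exact: pairing_component_linear.
Qed.

Lemma pairing_linr u v (f : @mor k (orbit_cat F) u v) : scalar (KC f).
Proof.
move=> a g g'.
apply: (homor_ext (phi := fun f => KC f (a *: g + g') : k^o)
  (psi := fun f => a * KC f g + KC f g' : k^o)) => {f}.
- exact: pairing_linl.
- move=> b f f'; rewrite !pairing_linl -[RHS]/(b * _ + _) !mulrDr !addrA.
  by congr (_ + _); rewrite addrAC mulrCA.
move=> p f; rewrite !pairing_homorl component_linear untwist_linear.
by rewrite kappa_linr mulrDr mulrCA.
Qed.

Lemma pairing_homorr p u v (f : @mor k (orbit_cat F) u v)
    (g : mor v (F p^-1%g (S u))) :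
  KC f (homor g) = chi p * kappa (component p f) (untwist g).
Proof.
apply: (homor_ext (phi := fun f => KC f (homor (F := F) g) : k^o)
  (psi := fun f => chi p * kappa (component p f) (untwist g) : k^o)) => {f}.
- exact: pairing_linl.
- by move=> b f f'; rewrite component_linear kappa_linl mulrDr mulrCA.
move=> q f; rewrite pairing_homorl; have [e|qp] := eqVneq q p.
  by subst q; rewrite !component_homor.
have pq : p^-1%g != q^-1%g by rewrite (inj_eq invg_inj) eq_sym.
rewrite !component_homorN //.
by rewrite (linear_0 (@untwist_linear _ _ _ _ _ _ _)) kappa0l kappa0r !mulr0.
Qed.

Lemma pairing_homog0 p q u v (f : @mor k (orbit_cat F) u v)
    (g : @mor k (orbit_cat F) v (S u)) :
  homog p f -> homog q g -> q != p^-1%g -> KC f g = 0.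
Proof.
move=> /homogP-> /homogP-> qp.
rewrite pairing_homorl component_homorN //.
by rewrite (linear_0 (@untwist_linear _ _ _ _ _ _ _)) kappa0r mulr0.
Qed.

Lemma orbit_homog_fin_dim p x y :
  fin_dim (fun f : @mor k (orbit_cat F) x y => homog p f).
Proof.
have [n [b [_ bP]]] := serre_fin_dim hk x (F p y).
exists n, (fun i => homor (b i)); split=> [i|f /homogP->].
  exact: homog_homor.
have [c ->] := bP (component p f) I; exists c.
rewrite (linear_sum _ _ (@homor_linear _ _ _ _ _ _ _)).
by apply: eq_bigr => i _; rewrite (linear_Z _ _ (@homor_linear _ _ _ _ _ _ _)).
Qed.

(** Pairing with morphisms of degree p^-1 recovers the degree p component, since
    these are in bijection with everything that this component is paired with
    in D. *)
Lemma pairing_inj u v (f f' : @mor k (orbit_cat F) u v) :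
  KC f = KC f' -> f = f'.
Proof.
move=> e; apply: componentP => p.
apply: (dual_iso_inj (serre_dual hk u (F p v))); apply/funext => w.
have [g <-] := untwist_surj w.
have := congr1 (fun phi => phi (homor g)) e; rewrite !pairing_homorr.
exact: (mulfI (char_neq0 chi p)).
Qed.

(** The restriction of phi to degree p^-1 is represented by Serre duality in D by
    some f p. Since phi vanishes outside finitely many degrees, so does the
    family f. *)
Lemma pairing_surj u v (phi : @mor k (orbit_cat F) v (S u) -> k) :
  graded_dual phi -> exists f, KC f = phi.
Proof.
case=> lphi [r hr].
have /(_ _)/cid f_ex : forall p, exists f : mor u (F p v),
    forall g, chi p * kappa f (untwist g) = phi (homor g).
  move=> p.
  have [t tP] := choice (@untwist_surj k G D F p (S u) v).
  have [_ _ /(_ (fun h => (chi p)^-1 * phi (homor (t h))))] :=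
    serre_dual hk u (F p v).
  case=> [a h h'|f [fE _]].
    rewrite mulrCA -mulrDr -lphi -homor_linear; congr (_ * phi (homor _)).
    by apply: untwist_inj; rewrite tP untwist_linear !tP.
  exists f => g; rewrite fE mulVKf ?char_neq0 //; congr (phi (homor _)).
  by apply: untwist_inj; rewrite tP.
pose f p := sval (f_ex p); have fP p g := svalP (f_ex p) g.
have f_fin : exists r : seq G, forall p, p \notin r -> f p = 0.
  exists [seq p^-1%g | p <- r] => p pr.
  apply: (dual_iso_inj (serre_dual hk u (F p v))); apply/funext => w.
  have [g <-] := untwist_surj w; apply: (mulfI (char_neq0 chi p)).
  rewrite fP kappa0l mulr0; apply: (hr p^-1%g); first exact: homog_homor.
  by apply: contraNN pr => pr; apply/mapP; exists p^-1%g; rewrite ?invgK.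
exists (DSum f_fin : @mor k (orbit_cat F) u v); apply/funext => g.
apply: (homor_ext
  (phi := fun g => KC (DSum f_fin : @mor k (orbit_cat F) u v) g : k^o)
  (psi := fun g => phi g : k^o)) => // [|{}q {}g].
  exact: pairing_linr.
by rewrite -(invgK q) in g *; rewrite pairing_homorr fP.
Qed.

(** Unless the three degrees multiply to 1 both sides vanish. Otherwise this is the
    corresponding identity in D for F p h and F p (F q t). The left side carries
    chi (p * q) and the right side chi p, whence the factor chi q. *)
Lemma pairing_compl p q r x y z (g : @mor k (orbit_cat F) x y)
    (h : @mor k (orbit_cat F) y z) (t : @mor k (orbit_cat F) z (S x)) :
  homog p g -> homog q h -> homog r t ->
  KC (h \oc g) t = chi q * KC g (t \oc h).
Proof.
move=> hg hh ht; have [rE|rN] := eqVneq r (p * q)^-1%g; last first.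
  rewrite (pairing_homog0 (homogM hg hh) ht rN).
  rewrite (pairing_homog0 hg (homogM hh ht)) ?mulr0 //.
  apply: contra_neq rN => e; apply: (mulgI q).
  by rewrite e invgM mulgA mulgV mul1g.
subst r; rewrite (homogP hg) (homogP hh) (homogP ht).
move: (component _ g) (component _ h) (component _ t) => {hg hh ht}{}g {}h {}t.
rewrite !homor_comp pairing_homorr component_homor pairing_homorl charM.
have e : (q * (p * q)^-1 = p^-1)%g by rewrite invgM mulgA mulgV mul1g.
rewrite (component_homor_cast e) mulrA [chi q * _]mulrC; congr (_ * _).
rewrite (untwistM t (act_objMV F p q (S x))) /orbit_comp_homog kappa_cast.
rewrite (serre_compl hk) comp_castcod; congr (kappa _ _).
rewrite /untwist !fmap_castcod (fmapM (functorP (F p))) !castcod_trans.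
by congr (castcod _ _); exact: Prop_irrelevance.
Qed.

(** Here kappa is evaluated in D at F p g on the left and at g on the right, and
    passing from one to the other is the defining property of zeta p. The
    factor chi p in s p compensates for the difference between chi (p * q) and
    chi q, so that no scalar is left. *)
Lemma pairing_compr p q r w x y (f : @mor k (orbit_cat F) w x)
    (g : @mor k (orbit_cat F) x y) (t : @mor k (orbit_cat F) y (S w)) :
  homog p f -> homog q g -> homog r t ->
  KC (g \oc f) t = KC g (fmap SC f \oc t).
Proof.
move=> hf hg ht; have hSf : homog p (fmap SC f).
  by rewrite (homogP hf) orbit_serre_homor; apply: homog_homor.
have [rE|rN] := eqVneq r (p * q)^-1%g; last first.
  rewrite (pairing_homog0 (homogM hf hg) ht rN).
  rewrite (pairing_homog0 hg (homogM ht hSf)) //.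
  by apply: contra_neq rN => e; apply: (mulIg p); rewrite e invgM mulgVK.
subst r; rewrite (homogP hf) (homogP hg) (homogP ht) orbit_serre_homor.
move: (component _ f) (component _ g) (component _ t)
  => {hf hg ht hSf}{}f {}g {}t.
rewrite !homor_comp pairing_homorr component_homor pairing_homorl charM.
have e : ((p * q)^-1 * p = q^-1)%g by rewrite invgM mulgVK.
rewrite (component_homor_cast e) (untwistM t (act_objMV F p q (S w))).
rewrite /orbit_comp_homog kappa_cast (serre_compr hk).
(* Move the factor chi p of s p out of the pairing. *)
rewrite s_zeta compZl.
rewrite (linear_Z _ _ (@fmap_linear _ _ _ _ (functorP (F _)) _ _)).
rewrite compZl !(linear_Z _ _ (castcod_linear _))
  (linear_Z _ _ (@untwist_linear _ _ _ _ _ _ _)).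
rewrite (linear_Z (V := k^o) _ _ (kappa_linr _)) -mulrA mulrCA.
congr (_ * (_ * _)).
apply: (is_zeta_mate (zetaP p)).
rewrite /untwist !fmap_castcod (fmapM (functorP (F q))).
rewrite (fmapM (functorP (F p))) !castcod_trans -comp_castcod.
rewrite (fmap_actMV _ _ (esym (act_objMV F p q (S w)))) compA.
by rewrite comp_castcodr.
Qed.

End EquivariantSerre.

Theorem proposition4p32 (k : fieldType) (G : groupType) (chi : character G k)
    (D : lincat k) (F : UMagmaMorphism.type G (autom D))
    (S : prefunctor D D)
    (s : forall (p : G) (y : D), mor (S (F p y)) (F p (S y)))
    (kappa : forall x y : D, mor x y -> mor y (S x) -> k) :
  is_equivariant_serre chi F S s kappa ->
  is_hom_graded_serre (C := orbit_cat F) chi (orbit_serre_fun F S s)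
    (fun _ => 1%g) (orbit_serre_pairing F chi S kappa).
Proof.
move=> hS; have hk : is_serre S kappa by case: hS.
have iso (x y : orbit_cat F) phi :
    graded_dual (x := y) (y := orbit_serre_fun F S s x) phi ->
    exists! f : mor x y, orbit_serre_pairing F chi S kappa x y f = phi.
  move=> /(pairing_surj hS)[f fE]; exists f; split=> // f' f'E.
  by apply: (pairing_inj hS); rewrite fE.
split.
- exact: orbit_serre_autoequivalence hS.
- exact: orbit_homog_fin_dim hS.
- move=> p x y f /homogP->; rewrite (orbit_serre_homor hS) mulg1 invg1 mulg1.
  exact: homog_homor.
- exact: pairing_linl hS.
- move=> x y f; split.
    exact: (pairing_linr hS (f : @mor k (orbit_cat F) x y)).
  have [r [c [_ hc ->]]] := homog_span f.
  exists [seq p^-1%g | p <- r] => q g hg qr.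
  rewrite (linear_sum (W := k^o) _ _ (pairing_linl hS g)) big_seq.
  rewrite big1 // => p pr.
  apply: (pairing_homog0 hS (hc p) hg).
  by apply: contraNneq qr => ->; apply/mapP; exists p.
- exact: iso.
- move=> p x y f hf; rewrite invg1 mulg1; split.
    exact: (pairing_linr hS (f : @mor k (orbit_cat F) x y)).
  move=> q g hg qp; exact: (pairing_homog0 hS hf hg).
- move=> p x y phi; rewrite invg1 mulg1 => -[lphi hphi].
  have [|f [fE fu]] := iso x y phi.
    split=> //; exists [:: p^-1%g] => q g hg.
    by rewrite inE => /(hphi q g hg).
  exists f; split=> [|f' [_ f'E]]; last exact: fu.
  (* The components of f in degrees other than p pair to zero with everything. *)
  split=> // q qp.
  apply: (dual_iso_inj (serre_dual hk x (F q y))); apply/funext => h.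
  have [g <-] := untwist_surj h; apply: (mulfI (char_neq0 chi q)).
  rewrite -(pairing_homorr hS) fE (kappa0l hS) mulr0.
  by apply: (hphi q^-1%g); [exact: homog_homor|rewrite (inj_eq invg_inj)].
- move=> p q r x y z g h t hg hh ht; exact: (pairing_compl hS hg hh ht).
- move=> p q r w x y f g t hf hg ht; exact: (pairing_compr hS hf hg ht).
Qed.
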